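(* Let $G=(V,E,1,w)$ be a finite connected weighted graph (with all vertex measures equal to $1$), and let $f$ be an adjacency eigenfunction of $G$ corresponding to the eigenvalue $\rho$, which is not the spectral radius of $G$. Then, for each nodal domain $U$ of $f$, $f|_{\Omega_U}$ is a Dirichlet adjacency eigenfunction (with eigenvalue $\rho$) of $G_U$ with vanishing data on $B_D(G_U)$. Moreover, $\mu_1(G_U)=\rho$.
   Context: Weighted graph: a finite simple undirected graph with symmetric edge weights $w_{xy}=w_{yx}$, $w_{xy}>0$ if and only if $xy\in E(G)$. Its adjacency matrix $A(G)$ has entries $w_{xy}$, and $f\neq0$ is an adjacency eigenfunction for $\rho$ if $\sum_{v\sim u}w_{uv}f(v)=\rho f(u)$ for all $u$. Geometric representation: $K(G)$ is the one-dimensional simplicial complex (metric graph) in which each edge $xy$ is identified with an interval of length $l_{xy}=1/w_{xy}$. $\widetilde f:|K(G)|\to\mathbb R$ is the edgewise linear extension of $f$. A nodal domain of $f$ is a connected component $U$ of $|K(G)|\setminus\widetilde f^{-1}(0)$. The graph $G_U$ with Dirichlet boundary: its interior is $\Omega_U=U\cap V(G)$; the edges between vertices of $\Omega_U$ are the edges of $G$ between them, with unchanged weights. The Dirichlet boundary is $B_D(G_U)=B_U^0\cup\widetilde B_U^0$ (generated by $\partial U$), consisting of one boundary vertex for each edge $uv\in E(G)$ with $u\in\Omega_U$, $v\notin\Omega_U$: if $f(v)=0$ it is a copy $\widetilde v$ of $v$ (in $B_U^0$), joined to $u$; if $f(v)\ne0$ (then $f(u)f(v)<0$) it is the unique zero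 $z_{uv}$ of $\widetilde f$ on the edge $uv$ (in $\widetilde B_U^0$), joined to $u$. The weight of a boundary edge $uy$ lying on the edge $uv$ of $G$ is $w^U_{uy}=\frac1{l_{uy}}-\frac1{l_{uv}}$, where $l_{uy}$ is the length of the segment from $u$ to $y$; thus $w^U_{u\widetilde v}=0$ and $w^U_{uz_{uv}}=-w_{uv}f(v)/f(u)>0$. Dirichlet adjacency operator: on functions $g:\Omega_U\to\mathbb R$, $$\mathcal A_{\Omega_U}g(x)=\sum_{y\in\Omega_U,\,y\sim x}w_{xy}g(y)-\Big(\sum_{y\in B_D(G_U),\,y\sim x}w^U_{xy}\Big)g(x).$$ Its eigenvalues are called Dirichlet adjacency eigenvalues, ordered $\mu_1(G_U)\ge\mu_2(G_U)\ge\cdots$, and its eigenfunctions (extended by $0$ to $B_D(G_U)$) are the Dirichlet adjacency eigenfunctions of $G_U$ with vanishing data on $B_D(G_U)$. *)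

(* Defs.v *)
From HB Require Import structures.
From mathcomp Require Import all_boot all_order all_algebra.
From mathcomp Require Import all_classical all_reals all_analysis.
From mathcomp.real_closed Require Import complex polyrcf.

Set Implicit Arguments.
Unset Strict Implicit.
Unset Printing Implicit Defensive.

Import Order.TTheory GRing.Theory Num.Theory.
Import numFieldNormedType.Exports.

Local Open Scope classical_set_scope.
Local Open Scope ring_scope.

(* All vertex measures are 1, so they do not appear as data. *)
Record weighted_graph (R : realType) (V : finType) := WeightedGraph {
  edge : rel V;
  weight : V -> V -> R;
  edge_sym : forall x y, edge x y = edge y x;
  edge_irr : forall x, edge x x = false;
  weight_sym : forall x y, weight x y = weight y x;
  weight_ge0 : forall x y, 0 <= weight x y;
  weight_gt0 : forall x y, (0 < weight x y) = edge x y
}.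

Definition graph_connected (R : realType) (V : finType)
    (G : weighted_graph R V) : Prop :=
  forall x y : V, connect (edge G) x y.

Definition is_eigenfunction (R : realType) (I : finType)
    (T : (I -> R) -> I -> R) (rho : R) (g : I -> R) : Prop :=
  (exists x, g x != 0) /\ (forall x, T g x = rho * g x).

Definition adjacency_op (R : realType) (V : finType) (G : weighted_graph R V)
    (f : V -> R) (u : V) : R :=
  \sum_(v | edge G u v) weight G u v * f v.

Definition adjacency_mx (R : realType) (V : finType) (G : weighted_graph R V)
  : 'M[R]_#|V| :=
  \matrix_(i, j) weight G (enum_val i) (enum_val j).

Definition spectral_radius (R : realType) n (A : 'M[R]_n) : R :=
  sup [set ComplexField.Normc.normc z
      | z in [set z : R[i] | eigenvalue (map_mx (real_complex R) A) z]].

(* The real eigenvalues of A, with algebraic multiplicity, in nonincreasing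
   order ([rootsR] lists the distinct roots increasingly). *)
Definition spectrum (R : realType) n (A : 'M[R]_n) : seq R :=
  rev (flatten [seq nseq (mup x (char_poly A)) x | x <- rootsR (char_poly A)]).

Definition op_mx (R : realType) (I : finType) (T : (I -> R) -> I -> R)
  : 'M[R]_#|I| :=
  \matrix_(i, j) T (fun x => (x == enum_val j)%:R) (enum_val i).

Definition edge_length (R : realType) (V : finType) (G : weighted_graph R V)
    (u v : V) : R := 1 / weight G u v.

(* Points of |K(G)| are given by barycentric coordinates, i.e. |K(G)| is
   realized inside {ptws V -> R}, which is R^V with the product topology. *)
Definition vertex_point (R : realType) (V : finType) (u : V) : {ptws V -> R} :=
  fun x => (x == u)%:R.

(* The arc-length chart of the edge uv: the point at distance s from u, for
   0 <= s <= edge_length G u v. *)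
Definition edge_point (R : realType) (V : finType) (G : weighted_graph R V)
    (u v : V) (s : R) : {ptws V -> R} :=
  fun x => (1 - s / edge_length G u v) * vertex_point R u x
           + s / edge_length G u v * vertex_point R v x.

Definition realization (R : realType) (V : finType) (G : weighted_graph R V)
  : set {ptws V -> R} :=
  [set p | (exists u, p = vertex_point R u) \/
           (exists u v s, [/\ edge G u v, 0 <= s <= edge_length G u v
                            & p = edge_point G u v s])].

(* The edgewise linear extension of f, in barycentric coordinates. *)
Definition linear_ext (R : realType) (V : finType) (f : V -> R)
    (p : {ptws V -> R}) : R :=
  \sum_x p x * f x.

Definition nonzero_part (R : realType) (V : finType) (G : weighted_graph R V)
    (f : V -> R) : set {ptws V -> R} :=
  realization G `\` linear_ext f @^-1` [set 0].

Definition is_nodal_domain (R : realType) (V : finType)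
    (G : weighted_graph R V) (f : V -> R) (U : set {ptws V -> R}) : Prop :=
  exists2 p, nonzero_part G f p
           & U = connected_component (nonzero_part G f) p.

Record dirichlet_graph (R : realType) := DirichletGraph {
  int_vertex : finType;
  bd_vertex : finType;
  int_edge : rel int_vertex;
  int_weight : int_vertex -> int_vertex -> R;
  bd_edge : int_vertex -> bd_vertex -> bool;
  bd_weight : int_vertex -> bd_vertex -> R
}.

Definition dirichlet_adjacency (R : realType) (H : dirichlet_graph R)
    (g : int_vertex H -> R) (x : int_vertex H) : R :=
  \sum_(y | int_edge x y) int_weight x y * g y
  - (\sum_(y | bd_edge x y) bd_weight x y) * g x.
Arguments dirichlet_adjacency {R} H g x.

(* [mu H k] is the k-th largest Dirichlet adjacency eigenvalue, k >= 1. *)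
Definition mu (R : realType) (H : dirichlet_graph R) (k : nat) : R :=
  nth 0 (spectrum (op_mx (dirichlet_adjacency H))) k.-1.

(* An eigenfunction with vanishing boundary data lives on interior and
   boundary vertices. *)
Definition is_dirichlet_eigenfunction (R : realType) (H : dirichlet_graph R)
    (rho : R) (F : int_vertex H + bd_vertex H -> R) : Prop :=
  (forall y, F (inr y) = 0) /\
  is_eigenfunction (dirichlet_adjacency H) rho (fun x => F (inl x)).

Definition extend0 (R : realType) (H : dirichlet_graph R)
    (g : int_vertex H -> R) : int_vertex H + bd_vertex H -> R :=
  fun z => match z with inl x => g x | inr _ => 0 end.

Definition Omega (R : realType) (V : finType) (U : set {ptws V -> R})
  : {set V} :=
  [set u | `[< U (vertex_point R u) >]]%SET.

(* A Dirichlet boundary vertex is encoded by the pair (u, v) for the edge uv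
   it lies on, with u in Omega_U and v outside.  [bd_copy] collects the copies
   of vertices v with f v = 0, [bd_zero] the zeros z_uv. *)
Definition bd_copy (R : realType) (V : finType) (G : weighted_graph R V)
    (f : V -> R) (U : set {ptws V -> R}) : {set V * V} :=
  [set e | [&& edge G e.1 e.2, e.1 \in Omega U, e.2 \notin Omega U
             & f e.2 == 0]]%SET.

Definition bd_zero (R : realType) (V : finType) (G : weighted_graph R V)
    (f : V -> R) (U : set {ptws V -> R}) : {set V * V} :=
  [set e | [&& edge G e.1 e.2, e.1 \in Omega U, e.2 \notin Omega U
             & f e.2 != 0]]%SET.

(* The distance from u to the zero of the linear extension on the edge uv;
   meaningful when f u * f v < 0, where that zero is unique. *)
Definition zero_dist (R : realType) (V : finType) (G : weighted_graph R V)
    (f : V -> R) (u v : V) : R :=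
  get [set s : R | 0 <= s <= edge_length G u v
                   /\ linear_ext f (edge_point G u v s) = 0].

(* l_uy for the boundary vertex y on the edge e = (u, v). *)
Definition bd_length (R : realType) (V : finType) (G : weighted_graph R V)
    (f : V -> R) (U : set {ptws V -> R}) (e : V * V) : R :=
  if e \in bd_copy G f U then edge_length G e.1 e.2
  else zero_dist G f e.1 e.2.

(* The graph G_U. *)
Definition nodal_graph (R : realType) (V : finType) (G : weighted_graph R V)
    (f : V -> R) (U : set {ptws V -> R}) : dirichlet_graph R :=
  @DirichletGraph R
    {x : V | x \in Omega U}
    {e : V * V | e \in bd_copy G f U :|: bd_zero G f U}%SET
    (fun x y => edge G (val x) (val y))
    (fun x y => weight G (val x) (val y))
    (fun x y => (val y).1 == val x)
    (fun x y => 1 / bd_length G f U (val y)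
                - 1 / edge_length G (val y).1 (val y).2).

Definition restr_Omega (R : realType) (V : finType) (G : weighted_graph R V)
    (f : V -> R) (U : set {ptws V -> R}) : int_vertex (nodal_graph G f U) -> R :=
  fun x => f (val x).
Arguments restr_Omega {R V} G f U x.

(* Main.v *)
(* The function [f] has constant sign on a nodal domain U, since [linear_ext f]
   is continuous without zero on the connected set U.  An edge leaving U ends
   either at a zero of [f] or at a vertex of the opposite sign, and in both
   cases the boundary weight, multiplied by [f u], gives back minus the term
   w_uv f(v); so [f] restricted to U is a Dirichlet eigenfunction for [rho].
   Up to sign it is a positive eigenvector of a matrix with nonnegative
   off-diagonal entries.  For any other real eigenvector [g], with eigenvalue
   [m], the row at which |g|/f is largest gives [m <= rho], so [rho] is the
   top eigenvalue. *)

Require Import Defs.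
From mathcomp Require Import all_boot all_order all_algebra.
From mathcomp Require Import all_classical all_reals all_analysis.
From mathcomp.real_closed Require Import polyrcf.
From mathcomp Require Import ring lra.

Import Order.TTheory GRing.Theory Num.Theory.
Import numFieldNormedType.Exports.

Local Open Scope classical_set_scope.
Local Open Scope ring_scope.

(** * Positive eigenvectors and the largest real eigenvalue of a matrix *)

Lemma char_poly_tr (R : comNzRingType) n (A : 'M[R]_n) :
  char_poly A^T = char_poly A.
Proof.
rewrite /char_poly -[in RHS]det_tr; congr (\det _); apply/matrixP => i j.
by rewrite !mxE eq_sym.
Qed.

(** [eigenvalueP] speaks of row eigenvectors; transposing, which keeps the characteristic
    polynomial, turns them into column eigenvectors. *)
Lemma root_char_polyP (F : fieldType) n (A : 'M[F]_n) (a : F) :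
  reflect (exists2 v : 'I_n -> F, (exists i, v i != 0)
             & forall i, \sum_j A i j * v j = a * v i)
          (root (char_poly A) a).
Proof.
rewrite -char_poly_tr -eigenvalue_root_char.
apply: (iffP eigenvalueP) => [[v Av v0]|[v [i vi] Av]].
  exists (v 0) => [|i].
    by have /rV0Pn[i vi] := v0; exists i.
  have /rowP/(_ i) := Av; rewrite !mxE => <-.
  by apply: eq_bigr => j _; rewrite mxE mulrC.
exists (\row_i v i); last by apply/rV0Pn; exists i; rewrite mxE.
apply/rowP => k; rewrite !mxE -Av.
by apply: eq_bigr => j _; rewrite !mxE mulrC.
Qed.

(** [rootsR] is increasing, so the largest root comes last and [rev] puts its block of copies
    first. *)
Lemma spectrum_max (R : realType) n (A : 'M[R]_n) (r : R) :
  root (char_poly A) r -> (forall x, root (char_poly A) x -> x <= r) ->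
  nth 0 (spectrum A) 0 = r.
Proof.
move=> rootr maxr; have chi_neq0 := monic_neq0 (char_poly_monic A).
have rootsE x : root (char_poly A) x = (x \in rootsR (char_poly A)).
  by rewrite -roots_on_rootsR.
have : sorted <%R (rootsR (char_poly A)) by exact: sorted_roots.
have : r \in rootsR (char_poly A) by rewrite -rootsE.
have : {in rootsR (char_poly A), forall x, x <= r}.
  by move=> x; rewrite -rootsE; apply: maxr.
rewrite /spectrum; case/lastP: (rootsR _) => // s y le_r.
rewrite mem_rcons inE => rs.
rewrite lt_sorted_pairwise pairwise_rcons => /andP[/allP lty _].
have yr : y = r.
  apply/eqP; rewrite eq_le le_r ?mem_rcons ?mem_head//=.
  by case/orP: rs => [/eqP->//|/lty/ltW].
rewrite yr map_rcons flatten_rcons rev_cat.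
(* A root has positive multiplicity, so its block is not empty. *)
suff : (0 < mup r (char_poly A))%N.
  by case: mup => // m _; rewrite -[m.+1]addn1 nseqD rev_cat.
by rewrite -XsubC_dvd// dvdp_XsubCl.
Qed.

Lemma spectrum_positive_eigenvector (R : realType) n (A : 'M[R]_n)
    (f : 'I_n -> R) (rho : R) :
  (0 < n)%N -> (forall i j, i != j -> 0 <= A i j) -> (forall i, 0 < f i) ->
  (forall i, \sum_j A i j * f j = rho * f i) ->
  nth 0 (spectrum A) 0 = rho.
Proof.
case: n A f => // n A f _ A_ge0 f_gt0 Af.
apply: spectrum_max => [|mu].
  by apply/root_char_polyP; exists f => //; exists ord0; rewrite gt_eqF.
case/root_char_polyP => g [k gk] Ag.
have [i _ max_i] := @arg_maxP _ _ _ ord0 xpredT (fun i => `|g i| / f i) isT.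
have gi_gt0 : 0 < `|g i|.
  have : 0 < `|g i| / f i.
    by apply: lt_le_trans (max_i k isT); rewrite divr_gt0 ?normr_gt0.
  by rewrite pmulr_lgt0// invr_gt0.
(* The multiple of [f] that agrees with [|g|] at [i] dominates [|g|] everywhere. *)
have {}max_i j : `|g j| <= `|g i| / f i * f j.
  by rewrite -ler_pdivrMr//; exact: max_i.
(* the row [i] of [A g = mu g], the diagonal entry being moved to the left *)
have le1 : (mu - A i i) * `|g i| <= \sum_(j | j != i) A i j * `|g j|.
  apply: (@le_trans _ _ `|(mu - A i i) * g i|).
    by rewrite normrM ler_wpM2r// ler_norm.
  rewrite mulrBl -Ag (bigD1 i)//= addrAC subrr add0r.
  apply: le_trans (ler_norm_sum _ _ _) _; apply: ler_sum => j ji.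
  by rewrite normrM (ger0_norm (A_ge0 _ _ _)) // eq_sym.
(* Inserting this bound produces the off-diagonal part of row [i] of [A f = rho f]. *)
have le2 : \sum_(j | j != i) A i j * `|g j| <= (rho - A i i) * `|g i|.
  have -> : (rho - A i i) * `|g i| = \sum_(j | j != i) A i j * (`|g i| / f i * f j).
    transitivity (`|g i| / f i * (\sum_(j | j != i) A i j * f j)).
      have := Af i; rewrite (bigD1 i)//= => /(canRL (addKr _)) ->.
      by field; rewrite gt_eqF.
    by rewrite mulr_sumr; apply: eq_bigr => j _; ring.
  by apply: ler_sum => j ji; rewrite ler_wpM2l// A_ge0// eq_sym.
by have := le_trans le1 le2; rewrite ler_pM2r// lerD2r.
Qed.

(** Boundary weights enter the matrix only on the diagonal, so its off-diagonal entries are interior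
    weights or 0. The vertex [x0] makes the dimension positive. *)
Lemma mu1_positive_eigenfunction (R : realType) (H : dirichlet_graph R)
    (g : int_vertex H -> R) (rho : R) (x0 : int_vertex H) :
  (forall x y : int_vertex H, int_edge x y -> 0 <= int_weight x y) ->
  (forall x, 0 < g x) ->
  (forall x, dirichlet_adjacency H g x = rho * g x) -> mu H 1 = rho.
Proof.
move=> w_ge0 g_gt0 Tg; rewrite /mu/=.
pose c (x : int_vertex H) := \sum_(y | bd_edge x y) bd_weight x y.
have opE i j : op_mx (dirichlet_adjacency H) i j =
    (if int_edge (enum_val i) (enum_val j)
     then int_weight (enum_val i) (enum_val j) else 0) -
    c (enum_val i) * (i == j)%:R.
  rewrite mxE /dirichlet_adjacency (inj_eq enum_val_inj); congr (_ - _).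
  rewrite big_mkcond (bigD1 (enum_val j))//= eqxx mulr1 big1 ?addr0// => y /negPf->.
  by rewrite mulr0 if_same.
apply: (@spectrum_positive_eigenvector _ _ _ (g \o enum_val)) => /=.
- by apply/card_gt0P; exists x0.
- move=> i j /negPf ij; rewrite opE ij mulr0 subr0.
  by case: ifP => // /w_ge0.
- by move=> i.
move=> i; rewrite -Tg /dirichlet_adjacency -/(c _).
under eq_bigr do rewrite opE mulrBl.
rewrite sumrB; congr (_ - _).
  rewrite [RHS]big_mkcond [RHS](reindex _ (onW_bij _ (enum_val_bij _)))/=.
  by apply: eq_bigr => j _; case: ifP; rewrite ?mul0r.
rewrite (bigD1 i)//= eqxx mulr1 big1 ?addr0// => j.
by rewrite eq_sym => /negPf->; rewrite mulr0 mul0r.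
Qed.

(** * Topology of the geometric representation and the sign of the linear extension *)

Lemma prod_topology_continuous (T : topologicalType) (I : Type)
    (K : I -> topologicalType) (h : T -> prod_topology K) :
  (forall i, continuous (fun t => h t i)) -> continuous h.
Proof.
move=> hi t; apply/cvg_sup => i.
exact: (@continuous_comp_initial _ _ _ (@proj _ K i) h (hi i)).
Qed.

Section realization.
Context {R : realType} {V : finType} (G : weighted_graph R V) (f : V -> R).

Lemma linear_ext_continuous : continuous (linear_ext f).
Proof.
have projC x : continuous (fun p : {ptws V -> R} => p x : R).
  exact: (@proj_continuous V (fun=> R) x).
have addC : continuous (fun z : R * R => z.1 + z.2).
  by move=> z; apply: cvgD; [exact: cvg_fst|exact: cvg_snd].
apply: (@continuous_big R V +%R 0 xpredT addC _ (index_enum V)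
  (fun x (p : {ptws V -> R}) => p x * f x)).
move=> x _ p; apply: (@continuous_comp _ _ _ (fun q : {ptws V -> R} => q x)
  (fun r => r * f x)); first exact: projC.
by apply: cvgMr_tmp; exact: cvg_id.
Qed.

Lemma linear_ext_vertex u : linear_ext f (vertex_point R u) = f u.
Proof.
rewrite /linear_ext (bigD1 u)//= /vertex_point eqxx mul1r big1 ?addr0// => x.
by move=> /negPf->; rewrite mul0r.
Qed.

Lemma linear_ext_edge u v s : linear_ext f (edge_point G u v s) =
  (1 - s / edge_length G u v) * f u + s / edge_length G u v * f v.
Proof.
rewrite -[in RHS](linear_ext_vertex u) -[in RHS](linear_ext_vertex v).
rewrite /linear_ext !mulr_sumr -big_split/=; apply: eq_bigr => x _.
by rewrite /edge_point mulrDl !mulrA.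
Qed.

Lemma edge_point_continuous u v : continuous (edge_point G u v).
Proof.
apply: prod_topology_continuous => x s; rewrite /edge_point.
apply: cvgD; apply: cvgMr_tmp; last exact: cvgMr_tmp.
by apply: cvgB; [exact: cvg_cst|exact: cvgMl].
Qed.

Lemma edge_length_gt0 u v : edge G u v -> 0 < edge_length G u v.
Proof. by rewrite -weight_gt0 => w_gt0; rewrite divr_gt0. Qed.

Lemma edge_point0 u v : edge_point G u v 0 = vertex_point R u.
Proof. by apply/funext => x; rewrite /edge_point !mul0r subr0 mul1r addr0. Qed.

Lemma edge_point_length u v :
  edge G u v -> edge_point G u v (edge_length G u v) = vertex_point R v.
Proof.
move=> /edge_length_gt0 l_gt0; apply/funext => x.
by rewrite /edge_point divff ?gt_eqF// subrr mul0r mul1r add0r.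
Qed.

(* Along an edge [linear_ext f] is affine, so it has no zero between two points
   where it has the same sign. *)
Lemma edge_same_component u v a b : edge G u v ->
  0 <= a <= edge_length G u v -> 0 <= b <= edge_length G u v ->
  0 < linear_ext f (edge_point G u v a) * linear_ext f (edge_point G u v b) ->
  connected_component (nonzero_part G f) (edge_point G u v a)
    (edge_point G u v b).
Proof.
move=> uv; wlog ab : a b / a <= b => [th|] al bl fab.
  case/orP: (le_total a b) => [ab|ba]; first exact: th.
  by apply: connected_component_sym; apply: th => //; rewrite mulrC.
have l_gt0 := edge_length_gt0 u v uv.
apply: (@connected_component_max _ _ (edge_point G u v @` `[a, b])).
- by exists a => //=; rewrite in_itv/= lexx.
- move=> _ [s + <-]; rewrite /= in_itv/= => /andP[as_ sb]; split.
    by right; exists u, v, s; split=> //; apply/andP; split; lra.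
  move: fab => /[swap]; rewrite /preimage /= !linear_ext_edge => fs fab.
  set A := (X in 0 < X * _) in fab; set B := (X in 0 < _ * X) in fab.
  (* The left side is [b - a] times the affine value at [s], interpolated from the values [A] at [a]
     and [B] at [b]. *)
  have : (s - a) * B + (b - s) * A = 0.
    rewrite -[RHS](mulr0 (b - a)) -fs /A /B; field; exact: lt0r_neq0.
  (* Multiplying by [A] leaves the products [A * B > 0] and [A * A >= 0], whatever the common
     sign. *)
  move=> /(congr1 (fun z => A * z)); rewrite mulr0 mulrDr mulrCA (mulrCA A) => sum0.
  have [sa|sa] := eqVneq s a; first by move: fab; rewrite /A -sa fs mul0r ltxx.
  suff : 0 < (s - a) * (A * B) + (b - s) * (A * A) by rewrite sum0 ltxx.
  apply: ltr_wpDr; first by rewrite mulr_ge0 ?subr_ge0 -?expr2 ?sqr_ge0.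
  by rewrite mulr_gt0// subr_gt0 lt_neqAle eq_sym sa.
- apply: connected_continuous_connected; first exact: segment_connected.
  exact/continuous_subspaceT/edge_point_continuous.
- by exists b => //=; rewrite in_itv/= lexx ab.
Qed.

Lemma component_same_sign p q :
  connected_component (nonzero_part G f) p q ->
  0 < linear_ext f p * linear_ext f q.
Proof.
move=> pq; pose C := connected_component (nonzero_part G f) p.
(* The component of a point outside the set is empty, so [pq] forces [p] into the nonzero part. *)
have Cp : C p by move: pq => [B [Bp sB cB] _]; exists B.
have : is_interval (linear_ext f @` C).
  apply/connected_intervalP/connected_continuous_connected.
    exact: component_connected.
  exact/continuous_subspaceT/linear_ext_continuous.
have CN r : C r -> linear_ext f r <> 0 by move=> /connected_component_sub[].
move=> itv; rewrite lt_neqAle eq_sym mulf_neq0 ?andTb; try by apply/eqP/CN.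
rewrite leNgt; apply/negP => lt0.
have [r Cr r0] : (linear_ext f @` C) 0.
  case: (ltP (linear_ext f p) 0) => fp.
    apply: (itv (linear_ext f p) (linear_ext f q)); [by exists p|by exists q|].
    by rewrite ltW//= ltW// -(nmulr_rlt0 _ fp).
  apply: (itv (linear_ext f q) (linear_ext f p)); [by exists q|by exists p|].
  rewrite fp andbT leNgt; apply/negP => fq.
  by move: lt0; rewrite ltNge mulr_ge0// ltW.
exact: CN r0.
Qed.

(* A nonzero point on an edge is joined to the endpoint where [linear_ext f]
   has the same sign. *)
Lemma component_has_vertex p : nonzero_part G f p ->
  exists u, connected_component (nonzero_part G f) p (vertex_point R u).
Proof.
move=> Np; have [[[u pu]|[u [v [s [uv sl pE]]]]] /= fp] := Np.
  by exists u; rewrite -pu; exact: connected_component_refl.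
have l_gt0 := edge_length_gt0 u v uv.
(* The positive square of [linear_ext f p] is a convex combination of these two products, so they
   are not both nonpositive. *)
have endpoints : 0 < linear_ext f p * f u \/ 0 < linear_ext f p * f v.
  apply/orP; rewrite -[_ || _]negbK negb_or -!leNgt; apply/negP => /andP[le_u le_v].
  have : 0 < linear_ext f p * linear_ext f p.
    by rewrite -expr2 exprn_even_gt0//=; exact/eqP.
  set t := s / edge_length G u v.
  have /andP[t0 t1] : 0 <= t <= 1.
    by case/andP: sl => s0 sl; rewrite divr_ge0 ?(ltW l_gt0)//= ler_pdivrMr ?mul1r.
  have {2}-> : linear_ext f p = (1 - t) * f u + t * f v.
    by rewrite pE linear_ext_edge.
  rewrite mulrDr !(mulrCA (linear_ext f p)).
  by rewrite ltNge -oppr_ge0 opprD addr_ge0// oppr_ge0 mulr_ge0_le0// subr_ge0.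
case: endpoints => fpv; [exists u|exists v].
  rewrite pE -(edge_point0 u v); apply: edge_same_component => //.
    by rewrite lexx ltW.
  by rewrite -pE edge_point0 linear_ext_vertex.
rewrite pE -(edge_point_length u v uv); apply: edge_same_component => //.
  by rewrite lexx ltW.
by rewrite -pE edge_point_length// linear_ext_vertex.
Qed.

End realization.

(** * Nodal domains and the Dirichlet operator of [nodal_graph] *)

Lemma OmegaP {R : realType} {V : finType} (U : set {ptws V -> R}) u :
  reflect (U (vertex_point R u)) (u \in Omega U).
Proof. by rewrite /Omega finset.in_set; exact: asboolP. Qed.

Section nodal_graph.
Context {R : realType} {V : finType} (G : weighted_graph R V) (f : V -> R).
Context (U : set {ptws V -> R}) (U_nodal : is_nodal_domain G f U).

Lemma Omega_same_sign u v : u \in Omega U -> v \in Omega U -> 0 < f u * f v.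
Proof.
case: U_nodal => p _ -> /OmegaP pu /OmegaP pv.
rewrite -(linear_ext_vertex f u) -(linear_ext_vertex f v).
apply: (component_same_sign G).
exact: connected_component_trans (connected_component_sym pu) pv.
Qed.

Lemma Omega_nonempty : exists u, u \in Omega U.
Proof.
case: U_nodal => p /component_has_vertex[u pu] UE.
by exists u; apply/OmegaP; rewrite UE.
Qed.

(** The edge has no zero, so it stays in one component. Contrapositively, an edge leaving U ends at
    a zero of [f] or at a vertex of opposite sign. *)
Lemma Omega_edge u v :
  edge G u v -> u \in Omega U -> 0 < f u * f v -> v \in Omega U.
Proof.
case: U_nodal => p _ -> uv /OmegaP pu fuv; apply/OmegaP.
apply: connected_component_trans pu _.
have l_gt0 := edge_length_gt0 G u v uv.
rewrite -(edge_point0 G u v) -(edge_point_length G u v uv).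
apply: edge_same_component; rewrite ?lexx ?ltW//.
by rewrite edge_point0 edge_point_length// !linear_ext_vertex.
Qed.

Lemma zero_distE u v : edge G u v -> f u * f v < 0 ->
  zero_dist G f u v = edge_length G u v * (f u / (f u - f v)).
Proof.
move=> uv fuv; have l_gt0 := edge_length_gt0 G u v uv.
have fu0 : f u != 0 by apply: contraTneq fuv => ->; rewrite mul0r ltxx.
have d_neq0 : f u - f v != 0.
  by apply: contraTneq fuv => /subr0_eq <-; rewrite -leNgt -expr2 sqr_ge0.
rewrite /zero_dist; set P := [set s | _].
(* [get] picks some element of [P], so both uniqueness and existence are needed. The value solves
   [(1 - t) * f u + t * f v = 0] for [t = s / edge_length G u v]. *)
suff PE s : P s -> s = edge_length G u v * (f u / (f u - f v)).
  apply: PE; apply: (getPex (P := P)).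
  exists (edge_length G u v * (f u / (f u - f v))); split; last first.
    by rewrite linear_ext_edge; field; rewrite d_neq0 gt_eqF.
  suff /andP[t0 t1] : 0 <= f u / (f u - f v) <= 1.
    by rewrite mulr_ge0 ?(ltW l_gt0)//= ger_pMr.
  (* Expanding by [f u] makes numerator and denominator positive without a case split on the sign of
     [f u]. *)
  have -> : f u / (f u - f v) = f u ^+ 2 / (f u ^+ 2 - f u * f v).
    by rewrite expr2 -mulrBr -mulf_div divff// mul1r.
  have d_gt0 : 0 < f u ^+ 2 - f u * f v.
    by rewrite subr_gt0 (lt_le_trans fuv)// sqr_ge0.
  rewrite divr_ge0 ?sqr_ge0 ?(ltW d_gt0)//= ler_pdivrMr// mul1r lerBrDl.
  by rewrite gerDr ltW.
case=> _; rewrite linear_ext_edge => s0.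
have sE : s / edge_length G u v * (f u - f v) = f u.
  by apply/subr0_eq; rewrite -[RHS]oppr0 -s0; ring.
by rewrite -{1}sE; field; rewrite d_neq0 gt_eqF.
Qed.

(** If [f v = 0], both sides vanish. Otherwise the reciprocal distance to the zero is
    [w (f u - f v) / f u], where [w] is the edge weight, and subtracting [w] leaves
    [- w f v / f u]. *)
Lemma bd_weightE u v : edge G u v -> u \in Omega U -> v \notin Omega U ->
  1 / bd_length G f U (u, v) - 1 / edge_length G u v =
  - (weight G u v * f v / f u).
Proof.
move=> uv uU vU; rewrite /bd_length /bd_copy finset.in_set /= uv uU vU /=.
have fu0 : f u != 0.
  by apply: contraTneq (Omega_same_sign u u uU uU) => ->; rewrite mul0r ltxx.
have [fv0|fv0] := eqVneq (f v) 0; first by rewrite fv0 mulr0 mul0r subrr oppr0.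
have fuv : f u * f v < 0.
  rewrite lt_neqAle mulf_neq0//= leNgt; apply: contra vU; exact: Omega_edge.
have d_neq0 : f u - f v != 0.
  by apply: contraTneq fuv => /subr0_eq <-; rewrite -leNgt -expr2 sqr_ge0.
have w_neq0 : weight G u v != 0 by rewrite gt_eqF// weight_gt0.
rewrite zero_distE// /edge_length; field.
by rewrite fu0 w_neq0 d_neq0.
Qed.

Lemma dirichlet_adjacency_restr x :
  dirichlet_adjacency (nodal_graph G f U) (restr_Omega G f U) x =
  adjacency_op G f (val x).
Proof.
case: x => u uU; rewrite /dirichlet_adjacency /adjacency_op/=.
have fu0 : f u != 0.
  by apply: contraTneq (Omega_same_sign u u uU uU) => ->; rewrite mul0r ltxx.
rewrite [RHS](bigID (mem (Omega U)))/=; congr (_ + _).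
  under [RHS]eq_bigl do rewrite andbC.
  by rewrite (big_sub_cond (mem (Omega U)) (edge G u)
    (fun v => weight G u v * f v)).
pose bd := (bd_copy G f U :|: bd_zero G f U)%SET.
(* The two kinds of boundary vertices together are exactly the edges leaving U. *)
have bdE v : ((u, v) \in bd) = edge G u v && (v \notin Omega U).
  by rewrite finset.in_setU !(finset.in_set _ (u, v)) /= uU -!andb_orr orbN andbT.
rewrite -(big_sub_cond (mem bd) (fun e => e.1 == u)
  (fun e => 1 / bd_length G f U e - 1 / edge_length G e.1 e.2)).
(* Boundary vertices joined to [u] are pairs [(u, v)], so the sum runs over the outer neighbours
   [v]. *)
rewrite (reindex_onto (pair u) snd) => [|[a b] /andP[_ /eqP /= ->]//].
rewrite /= eqxx; under eq_bigl => v do rewrite eqxx !andbT bdE.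
rewrite mulr_suml -sumrN; apply: eq_bigr => v /andP[uv vU].
by rewrite bd_weightE// mulNr opprK divfK.
Qed.

End nodal_graph.

Theorem theorem4p3 (R : realType) (V : finType) (G : weighted_graph R V)
    (G_connected : graph_connected G)
    (f : V -> R) (rho : R)
    (f_eigen : is_eigenfunction (adjacency_op G) rho f)
    (rho_not_radius : rho <> spectral_radius (adjacency_mx G))
    (U : set {ptws V -> R}) (U_nodal : is_nodal_domain G f U) :
  is_dirichlet_eigenfunction rho (extend0 (restr_Omega G f U))
  /\ mu (nodal_graph G f U) 1 = rho.
Proof.
have [u uU] := Omega_nonempty G f U U_nodal.
have sign v w := Omega_same_sign G f U U_nodal v w.
have restrE x : dirichlet_adjacency (nodal_graph G f U) (restr_Omega G f U) x =
    rho * restr_Omega G f U x.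
  by rewrite dirichlet_adjacency_restr// f_eigen.2.
split.
  split=> //; split=> //; exists (Sub u uU) => /=.
  by apply: contraTneq (sign u u uU uU); rewrite /restr_Omega/= => ->; rewrite mul0r ltxx.
(* Since [f] has the sign of [f u] on all of [Omega U], the factor [f u] makes the eigenfunction
   positive in either case. *)
apply: (mu1_positive_eigenfunction _ _
  (fun x => f u * restr_Omega G f U x) _ (Sub u uU)).
- by move=> x y _; exact: weight_ge0.
- by move=> x; apply: sign => //; exact: valP x.
move=> x; rewrite mulrCA -restrE /dirichlet_adjacency mulrBr mulr_sumr.
congr (_ - _); last by rewrite mulrCA.
by apply: eq_bigr => y _; rewrite mulrCA.
Qed.
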